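(* Let $G=(V,E)$ be a connected graph with $n=|V|\ge2$, weights $w$ and costs $c$, and let $\Delta>0$. Suppose there is $F^*\subseteq E$ with $c(F^* )=B$ and $p_G(F^* )=\Delta$ (finite). Run the greedy procedure below with input budget $B'\ge B$, and assume every edge set whose removal disconnects $G$ has cost greater than $B'$. Then the output $F$ satisfies $p_G(F)\ge\Delta$ (and, by the stopping rule, $c(F)<(2+2\log n)B'$). Greedy procedure (input $G,B',\Delta$; $\mathcal{W}=\{w(e):e\in E\}$): initialize $F=\emptyset$, $b=0$, $G'=(V,E')=G$. Repeat the following step: for every edge $\{u,v\}\in E'$ and every $W\in\mathcal{W}$, let $C$ be a minimum-cost set of edges of $G''=(V,\{f\in E':w(f)<W\})$ separating $u$ from $v$ in $G''$, and $p=W-w(\{u,v\})$; among all such $(C,p)$ with $0<c(C)\le B'$ choose $C^*$ maximizing $p/c(C)$, and let $r^*$ be this maximum (if no candidate has positive ratio, $r^*=0$ and $C^*=\emptyset$). Then set $G'\leftarrow G'\setminus C^*$, $b\leftarrow b+c(C^* )$, $F\leftarrow F\cup C^*$. Repeat the step as long as $r^*>0$, $b<(1+2\log n)B'$ and $p_G(F)<\Delta$. Finally output $F$ if $p_G(F)\ge\Delta$, and $\emptyset$ otherwise.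
   Context: $w:E\to\mathbb{R}_{\ge0}$, $c:E\to\mathbb{R}_{>0}$, $c(D)=\sum_{f\in D}c(f)$, $G\setminus D=(V,E\setminus D)$. $\mathrm{MST}(\cdot)$ is minimum spanning tree weight w.r.t. $w$ ($\infty$ for disconnected graphs); $p_G(D)=\mathrm{MST}(G\setminus D)-\mathrm{MST}(G)$. $\log=\log_2$. *)

(* Defs.v *)
From HB Require Import structures.
From mathcomp Require Import all_boot all_order all_algebra.
From mathcomp Require Import all_classical all_reals exp.
Set Implicit Arguments. Unset Strict Implicit. Unset Printing Implicit Defensive.
Import Order.TTheory GRing.Theory Num.Theory.
Local Open Scope ring_scope.

Section Graph.
Variables (R : realType) (V E : finType) (eu ev : E -> V) (w c : E -> R).

Definition simple_graph : Prop :=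
  (forall e, eu e != ev e) /\
  (forall e f, [set eu e; ev e] = [set eu f; ev f] -> e = f).

Definition adj (S : {set E}) : rel V := fun x y =>
  [exists e in S, ((eu e == x) && (ev e == y)) || ((eu e == y) && (ev e == x))].

Definition conn (S : {set E}) (x y : V) : bool := connect (adj S) x y.

Definition connectedb (S : {set E}) : bool := [forall x, [forall y, conn S x y]].

(* T is a spanning tree of (V, S): T is a spanning connected subgraph of S
   that is acyclic (no edge of T lies on a cycle of T, i.e. removing it
   disconnects its endpoints in T). *)
Definition is_spanning_tree (S T : {set E}) : bool :=
  [&& T \subset S, connectedb T &
      [forall e in T, ~~ conn (T :\ e) (eu e) (ev e)]].

(* MST weight of (V, S); +oo if there is no spanning tree (disconnected). *)
Definition MST (S : {set E}) : \bar R :=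
  \big[Order.min/+oo%E]_(T : {set E} | is_spanning_tree S T) ((\sum_(e in T) w e)%:E).

Definition pG (D : {set E}) : \bar R := (MST (~: D) - MST [set: E])%E.

Definition cost (D : {set E}) : R := \sum_(f in D) c f.

Definition log2 (x : R) : R := ln x / ln 2.

Definition light (E' : {set E}) (W : R) : {set E} := [set f in E' | w f < W].

Definition separates (S : {set E}) (x y : V) (C : {set E}) : bool :=
  (C \subset S) && ~~ conn (S :\: C) x y.

Definition min_sep (S : {set E}) (x y : V) (C : {set E}) : Prop :=
  separates S x y C /\ forall C', separates S x y C' -> cost C <= cost C'.

Definition candidate (B' : R) (E' : {set E}) (e : E) (W : R) (C : {set E}) : Prop :=
  [/\ e \in E', (exists e0, W = w e0), min_sep (light E' W) (eu e) (ev e) C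
    & (0 < cost C <= B')].

Definition ratio (e : E) (W : R) (C : {set E}) : R := (W - w e) / cost C.

Definition greedy_step (B' : R) (E' : {set E}) (Cs : {set E}) (rs : R) : Prop :=
  (0 < rs /\ exists e W, [/\ candidate B' E' e W Cs, rs = ratio e W Cs &
       forall e' W' C', candidate B' E' e' W' C' -> ratio e' W' C' <= rs])
  \/
  [/\ rs = 0, Cs = (finset.set0 : {set E}) &
       forall e' W' C', candidate B' E' e' W' C' -> ratio e' W' C' <= 0].

(* A run is the list of selected (C*_i, r*_i), i = 1..k. *)
Definition Fpre (s : seq ({set E} * R)) (i : nat) : {set E} :=
  \big[@finset.setU E/(finset.set0 : {set E})]_(p <- take i s) p.1.

Definition bpre (s : seq ({set E} * R)) (i : nat) : R :=
  \sum_(p <- take i s) cost p.1.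

(* continuation condition after i >= 1 steps *)
Definition continue_cond (B' Delta : R) (s : seq ({set E} * R)) (i : nat) : Prop :=
  [/\ 0 < (nth ((finset.set0 : {set E}), 0) s i.-1).2,
      bpre s i < (1 + 2 * log2 #|V|%:R) * B' &
      (pG (Fpre s i) < Delta%:E)%E].

Definition greedy_run (B' Delta : R) (s : seq ({set E} * R)) : Prop :=
  [/\ (0 < size s)%N,
      (forall i, (i < size s)%N ->
         greedy_step B' (~: Fpre s i) (nth ((finset.set0 : {set E}), 0) s i).1 (nth ((finset.set0 : {set E}), 0) s i).2),
      (forall i, (0 < i < size s)%N -> continue_cond B' Delta s i) &
      ~ continue_cond B' Delta s (size s)].

Definition greedy_output (Delta : R) (s : seq ({set E} * R)) : {set E} :=
  if (Delta%:E <= pG (Fpre s (size s)))%E then Fpre s (size s) else (finset.set0 : {set E}).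

End Graph.

(* Main.v *)
Require Import Defs.
From HB Require Import structures.
From mathcomp Require Import all_boot all_order all_algebra.
From mathcomp Require Import all_classical all_reals exp.
From mathcomp Require Import fintype finset lra.
Import Order.TTheory GRing.Theory Num.Theory.
Set Implicit Arguments. Unset Strict Implicit. Unset Printing Implicit Defensive.
Local Open Scope ring_scope.

(** Up to a constant, the minimum spanning tree weight of a connected graph is
    the integral over [t] of the number of components of the edges lighter
    than [t]; hence it is supermodular in the removed edge set.
    Let [F] be the final removed set, [D = F :&: Fs] and [m] the (shifted) tree
    weight after removal. Two estimates suffice.
    - Charging the merges of Kruskal's algorithm on the graph without [Fs] to
      the smaller side shows that the best ratio is at least
      [(Delta - (m D - m 0)) / (2 * log n * B')] at every step.
    - By supermodularity and optimality of the chosen cuts, [m F - m D] is at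
      least the sum of [r_i * c (C_i :\: Fs)].
    A run that exhausts the budget pays at least [2 * log n * B'] outside [Fs],
    so that [m F - m 0 >= Delta]. *)

(** * Components of a graph given by a list of vertex pairs *)

Section Components.
Variable V : finType.
Implicit Types (Q : seq (V * V)) (p : V * V) (x y z : V) (A : {set V}).

(** Edges are bare vertex pairs, so that artificial edges outside the graph can be added later. *)
Definition padj Q : rel V := fun x y => ((x, y) \in Q) || ((y, x) \in Q).

Definition pconn Q x y := connect (padj Q) x y.

Definition component Q x : {set V} := [set y | pconn Q x y].

Definition ncomp Q : nat := #|[set component Q x | x : V]|.

Definition pclosed Q A : bool :=
  all (fun p => (p.1 \in A) == (p.2 \in A)) Q.

Lemma pconn_sym Q x y : pconn Q x y = pconn Q y x.
Proof. by apply: sym_connect_sym => a b; rewrite /padj orbC. Qed.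

Lemma pconn_refl Q x : pconn Q x x.
Proof. exact: connect0. Qed.

Lemma pconn_trans Q y x z : pconn Q x y -> pconn Q y z -> pconn Q x z.
Proof. exact: connect_trans. Qed.

Lemma mem_pconn Q p : p \in Q -> pconn Q p.1 p.2.
Proof. by case: p => a b ab; apply: connect1; rewrite /padj ab. Qed.

Lemma pconn_sub Q Q' x y :
  {in Q, forall p, pconn Q' p.1 p.2} -> pconn Q x y -> pconn Q' x y.
Proof.
move=> sub; apply: connect_sub => a b /orP[] /sub //=.
by rewrite pconn_sym.
Qed.

Lemma pconnW Q Q' x y : {subset Q <= Q'} -> pconn Q x y -> pconn Q' x y.
Proof. by move=> sub; apply: pconn_sub => p /sub /mem_pconn. Qed.

Lemma pclosed_pconn Q A x y :
  pclosed Q A -> pconn Q x y -> (x \in A) = (y \in A).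
Proof.
move=> /allP cl; apply: (@closed_connect _ _ (mem A)) => a b.
by case/orP=> /cl /eqP //= ->.
Qed.

Lemma pclosed_component Q x : pclosed Q (component Q x).
Proof.
apply/allP => p pQ; rewrite !inE; apply/eqP; apply/idP/idP => h.
  exact: pconn_trans h (mem_pconn pQ).
by apply: pconn_trans h _; rewrite pconn_sym mem_pconn.
Qed.

Lemma mem_component Q x : x \in component Q x.
Proof. by rewrite inE pconn_refl. Qed.

Lemma eq_component Q x y : pconn Q x y -> component Q x = component Q y.
Proof.
move=> xy; apply/setP => z; rewrite !inE; apply/idP/idP; apply: pconn_trans => //.
by rewrite pconn_sym.
Qed.

Lemma component_sub_pclosed Q A x : pclosed Q A -> x \in A -> component Q x \subset A.
Proof.
by move=> cl xA; apply/subsetP => y; rewrite inE => /(pclosed_pconn cl) <-.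
Qed.

Lemma sub_pclosed Q Q' A : {subset Q <= Q'} -> pclosed Q' A -> pclosed Q A.
Proof. by move=> sub /allP cl; apply/allP => p /sub/cl. Qed.

Lemma eq_pconn Q Q' : Q =i Q' -> pconn Q =2 pconn Q'.
Proof. by move=> QQ' x y; apply/idP/idP; apply: pconnW => p; rewrite QQ'. Qed.

Lemma eq_kap Q Q' : pconn Q =2 pconn Q' -> ncomp Q = ncomp Q'.
Proof.
move=> QQ'; congr #|pred_of_set _|; apply: eq_imset => x.
by apply/setP => y; rewrite !inE QQ'.
Qed.

Lemma ncomp_mem Q Q' : Q =i Q' -> ncomp Q = ncomp Q'.
Proof. by move=> /eq_pconn /eq_kap. Qed.

Lemma component_cons Q p x :
  component (p :: Q) x =
  if (x \in component Q p.1) || (x \in component Q p.2)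
  then component Q p.1 :|: component Q p.2 else component Q x.
Proof.
have sub : {subset Q <= p :: Q} by move=> q; rewrite inE orbC => ->.
have pp : pconn (p :: Q) p.1 p.2 by rewrite mem_pconn ?mem_head.
apply/eqP; rewrite eqEsubset; apply/andP; split.
  apply: component_sub_pclosed; last first.
    by case: ifP => [|_]; rewrite ?inE ?pconn_refl.
  rewrite /pclosed /=; apply/andP; split.
    case: ifP => [_|]; first by rewrite !inE !pconn_refl orbT.
    move/negbT; rewrite negb_or => /andP[n1 n2].
    rewrite !inE pconn_sym; move: n1 n2; rewrite !inE => /negbTE-> n2.
    by rewrite pconn_sym (negbTE n2).
  case: ifP => _; last exact: pclosed_component.
  apply/allP => q qQ; rewrite !inE; apply/eqP.
  have := allP (pclosed_component Q p.1) q qQ; rewrite !inE => /eqP ->.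
  by have := allP (pclosed_component Q p.2) q qQ; rewrite !inE => /eqP ->.
apply/subsetP => y; case: ifP => [|_]; last first.
  by rewrite !inE; apply: pconnW.
rewrite !inE => h1 h2.
have cp z : pconn Q p.1 z || pconn Q p.2 z -> pconn (p :: Q) p.1 z.
  case/orP => /(pconnW sub) //; exact: pconn_trans.
by apply: pconn_trans (cp _ h2); rewrite pconn_sym cp.
Qed.

(** When the endpoints lie in distinct components [A] and [B], the family of components loses both
    and gains [A :|: B], which is not among the others. *)
Lemma ncomp_cons Q p : ncomp Q = (ncomp (p :: Q) + ~~ pconn Q p.1 p.2)%N.
Proof.
have [cp|ncp] := boolP (pconn Q p.1 p.2); rewrite ?addn0 ?addn1.
  apply: eq_kap => x y; apply/idP/idP.
    by apply: pconnW => q; rewrite inE orbC => ->.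
  apply: pconn_sub => q; rewrite inE => /orP[/eqP->//|]; exact: mem_pconn.
set A := component Q p.1; set B := component Q p.2.
have AB : A != B.
  apply: contraNneq ncp => AB; have := mem_component Q p.2.
  by rewrite -/B -AB inE.
set I := [set component Q x | x : V].
have AI : A \in I by apply: imset_f.
have BI : B \in I by apply: imset_f.
have -> : ncomp (p :: Q) = #|(A :|: B) |: (I :\ A :\ B)|.
  congr #|pred_of_set _|; apply/setP => Z; apply/imsetP/idP.
    case=> x _ ->; rewrite component_cons; case: ifP => [_|]; first by rewrite setU11.
    move/negbT; rewrite negb_or => /andP[nA nB].
    rewrite in_setU1 !in_setD1 imset_f // andbT; apply/orP; right.
    by apply/andP; split; [apply: contraNneq nB|apply: contraNneq nA] => E;
      have := mem_component Q x; rewrite E.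
  rewrite in_setU1 !in_setD1 => /orP[/eqP->|/and3P[ZB ZA /imsetP[x _ ZE]]].
    by exists p.1 => //; rewrite component_cons mem_component.
  exists x => //; rewrite component_cons; case: ifP => // /orP[]; rewrite inE => /eq_component.
    by move=> E; rewrite ZE -E eqxx in ZA.
  by move=> E; rewrite ZE -E eqxx in ZB.
have nAB : A :|: B \notin I :\ A :\ B.
  rewrite !in_setD1; apply/negP => /and3P[nB nA /imsetP[x _ E]].
  have : p.1 \in component Q x by rewrite -E inE mem_component.
  by rewrite inE => /eq_component E'; rewrite E E' eqxx in nA.
rewrite cardsU1 nAB /ncomp -/I (cardsD1 A) AI (cardsD1 B (I :\ A)) in_setD1 BI.
by rewrite eq_sym AB.
Qed.

Lemma ncomp_le Q Q' : {subset Q <= Q'} -> (ncomp Q' <= ncomp Q)%N.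
Proof.
move=> sub; rewrite (@ncomp_mem Q' (Q' ++ Q)); last first.
  by move=> p; rewrite mem_cat; case: (boolP (p \in Q)) => [/sub ->|]; rewrite ?orbF.
elim: Q' {sub} => //= p Q' IH; apply: leq_trans IH.
by rewrite (ncomp_cons (Q' ++ Q) p) leq_addr.
Qed.

(** Adding the pair [(x, y)] to both lists leaves the count for [Q] unchanged and lowers that for
    [Q'] by one; monotonicity then applies. *)
Lemma ncomp_lt Q Q' x y : {subset Q' <= Q} -> pconn Q x y -> ~~ pconn Q' x y ->
  (ncomp Q < ncomp Q')%N.
Proof.
move=> sub c nc; rewrite (ncomp_cons Q' (x, y)) nc addn1 ltnS.
rewrite (ncomp_cons Q (x, y)) c addn0; apply: ncomp_le => p.
by rewrite !inE => /orP[->//|/sub->]; rewrite orbT.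
Qed.

(** Diminishing returns: an edge of [Y] that joins two components in the presence of [Q2] also does
    so in the presence of the smaller [Q1]. *)
Lemma ncomp_supermod Q1 Q2 Y : {subset Q1 <= Q2} ->
  (ncomp Q2 + ncomp (Y ++ Q1) <= ncomp Q1 + ncomp (Y ++ Q2))%N.
Proof.
move=> sub; elim: Y => [|p Y IH] /=; first by rewrite addnC.
move: IH; rewrite (ncomp_cons (Y ++ Q1) p) (ncomp_cons (Y ++ Q2) p) !addnA.
have: (~~ pconn (Y ++ Q2) p.1 p.2 <= ~~ pconn (Y ++ Q1) p.1 p.2)%N.
  case: (boolP (pconn (Y ++ Q1) _ _)) => [h|_]; last by case: pconn.
  rewrite (pconnW _ h) // => q; rewrite !mem_cat.
  by case/orP => [->//|/sub->]; rewrite orbT.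
by move=> h1 h2; rewrite -(leq_add2r (~~ pconn (Y ++ Q1) p.1 p.2)); apply: leq_trans h2 _;
 rewrite leq_add2l.
Qed.

Lemma ncomp_nil : ncomp [::] = #|V|.
Proof.
rewrite /ncomp card_imset // => x y E; have := mem_component [::] y.
rewrite -E inE => /connectP[[|z l]] /=; first by move=> _ ->.
by [].
Qed.

Lemma ncomp_full Q x0 : (forall y, pconn Q x0 y) -> ncomp Q = 1%N.
Proof.
move=> h; apply/eqP/cards1P; exists (component Q x0).
apply/setP => Z; rewrite inE; apply/imsetP/eqP => [[y _ ->]|->]; last by exists x0.
by rewrite (eq_component (h y)).
Qed.

Lemma ncomp_gt0 Q x0 : (0 < ncomp Q)%N.
Proof. by apply/card_gt0P; exists (component Q x0); apply: imset_f. Qed.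

Lemma ncomp_eq1 Q x y : ncomp Q = 1%N -> pconn Q x y.
Proof.
move=> /eqP/cards1P[Z E].
have h z : component Q z = Z by apply/set1P; rewrite -E imset_f.
by have := mem_component Q y; rewrite h -(h x) inE.
Qed.

End Components.

(** * Kruskal merges and sums over weight levels *)

Section Merges.
Variables (R : realType) (V : finType).
Implicit Types (Q : seq (V * V)) (p : V * V) (x y z : V) (A : {set V}).
Implicit Types (l : seq (V * V * R)) (W : R).

Definition small Q p : {set V} :=
  if (#|component Q p.1| <= #|component Q p.2|)%N then component Q p.1 else component Q p.2.

(* The latest edge comes first in [l]; a pair [(A, t)] records a merge at weight
   [t] whose smaller side is [A]. *)
Fixpoint merges l : seq ({set V} * R) :=
  if l is q :: l' then
    if pconn (unzip1 l') q.1.1 q.1.2 then merges l'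
    else (small (unzip1 l') q.1, q.2) :: merges l'
  else [::].

(** Sorting puts heavy edges first, so the tail read first by [merges] holds the light ones, as in
    Kruskal's order. *)
Definition heavier : rel (V * V * R) := fun a b => b.2 <= a.2.

Lemma heavier_trans : transitive heavier.
Proof. by move=> b a d ab bd; apply: le_trans bd ab. Qed.

Lemma heavier_total : total heavier.
Proof. by move=> a b; apply: le_total. Qed.

Lemma pclosed_small Q p : pclosed Q (small Q p).
Proof. by rewrite /small; case: ifP => _; apply: pclosed_component. Qed.

Lemma small_endpoints Q p : ~~ pconn Q p.1 p.2 ->
  (p.1 \in small Q p) != (p.2 \in small Q p).
Proof.
rewrite /small => nc; case: ifP => _; rewrite !inE pconn_refl.
  by rewrite (negbTE nc).
by rewrite pconn_sym (negbTE nc).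
Qed.

(** Each time [z] is on the smaller side of a merge, its component at least doubles. *)
Lemma count_merges l z :
  (2 ^ count (fun a : {set V} * R => z \in a.1) (merges l) <= #|component (unzip1 l) z|)%N.
Proof.
elim: l => [|[p om] l IH] /=.
  by apply/card_gt0P; exists z; rewrite mem_component.
have mono : (#|component (unzip1 l) z| <= #|component (p :: unzip1 l) z|)%N.
  apply: subset_leq_card; apply/subsetP => y; rewrite !inE.
  by apply: pconnW => q; rewrite inE orbC => ->.
case: ifP => [_|/negbT nc] /=; first exact: leq_trans IH mono.
case: (boolP (z \in _)) => [zs|_]; last exact: leq_trans IH mono.
rewrite add1n expnS.
set Q := unzip1 l in nc zs IH mono *.
have dis : [disjoint component Q p.1 & component Q p.2].
  apply/pred0P => y /=; apply: contraNF nc; rewrite !inE => /andP[h1 h2].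
  by apply: pconn_trans h1 _; rewrite pconn_sym.
have zE : (z \in component Q p.1) || (z \in component Q p.2).
  by move: zs; rewrite /small; case: ifP => _ ->; rewrite ?orbT.
rewrite component_cons zE cardsU (eqP (_ : component Q p.1 :&: component Q p.2 == finset.set0)); last first.
  by rewrite setI_eq0.
rewrite cards0 subn0 mul2n -addnn.
have cz : (#|component Q z| <= #|component Q p.1|)%N && (#|component Q z| <= #|component Q p.2|)%N.
  move: zs; rewrite /small; case: ifP => [le|/negbT]; rewrite ?inE.
    by move=> /eq_component <-; rewrite leqnn.
  by rewrite -ltnNge => /ltnW le /eq_component <-; rewrite leqnn le.
by case/andP: cz => c1 c2; apply: leq_add; apply: leq_trans IH _.
Qed.

(** A smaller side closed under [Q] is closed under the earlier edges together with [Q], yet the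
    merging edge leaves it. That edge thus also joins two components of this larger list, and such
    drops start from [ncomp Q]. *)
Lemma count_merges_pclosed l Q :
  (count (fun a : {set V} * R => pclosed Q a.1) (merges l) + ncomp (unzip1 l ++ Q) <= ncomp Q)%N.
Proof.
elim: l => [|[p om] l IH] //=; apply: leq_trans IH.
rewrite [X in (_ <= _ + X)%N](ncomp_cons _ p).
case: ifP => [_|/negbT nc] /=; first by rewrite addnA leq_addr.
rewrite -addnA addnCA leq_add2l addnC leq_add2l.
case: (boolP (pclosed Q _)) => //= cl; rewrite lt0b.
have cl2 : pclosed (unzip1 l ++ Q) (small (unzip1 l) p).
  by rewrite /pclosed all_cat; apply/andP; split => //; apply: pclosed_small.
apply/negP => /(pclosed_pconn cl2) E.
by move: (small_endpoints nc); rewrite E eqxx.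
Qed.

Lemma merges_weight l a : a \in merges l -> a.2 \in map snd l.
Proof.
elim: l => [|q l IH] //=; rewrite inE; case: ifP => _; last rewrite inE.
  by move/IH => ->; rewrite orbT.
by case/orP => [/eqP->|/IH->]; rewrite ?eqxx ?orbT.
Qed.

Lemma sorted_merges q l a : sorted heavier (q :: l) -> a \in merges l -> a.2 <= q.2.
Proof.
move=> /= /(order_path_min heavier_trans) /allP h /merges_weight /mapP[b bl ->].
exact: h.
Qed.

(** In sorted order the edges lighter than [W] form the tail of the list, and each later merge
    lowers the component count by one. *)
Lemma count_merges_level l W : sorted heavier l ->
  (count (fun a : {set V} * R => W <= a.2)%R (merges l) + ncomp (unzip1 l))%N =
  ncomp (unzip1 [seq q <- l | q.2 < W]).
Proof.
elim: l => [|[p om] l IH] // srt; have /= srt' := path_sorted srt.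
have [Wom|omW] := leP W om.
  rewrite -(IH srt') (ncomp_cons (unzip1 l) p).
  case: (pconn _ _ _) => /=; first by rewrite addn0.
  by rewrite Wom addn1 add1n addSn addnS.
have -> : [seq q <- l | q.2 < W] = l.
  apply/all_filterP/allP => q ql.
  apply: le_lt_trans omW.
  by move: srt => /= /(order_path_min heavier_trans) /allP /(_ q ql).
rewrite [X in (X + _)%N](_ : _ = 0%N) //; apply/eqP; rewrite eqn0Ngt -has_count; apply/hasPn => a aM /=.
rewrite -ltNge; apply: le_lt_trans omW.
move: aM => /=; case: ifP => _; last rewrite inE => /orP[/eqP-> //|];
  exact: (sorted_merges srt).
Qed.

(** All edges lighter than the merge precede it, and at that moment its smaller side is a whole
    component. *)
Lemma merges_pclosed l a : sorted heavier l -> a \in merges l ->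
  pclosed (unzip1 [seq q <- l | q.2 < a.2]) a.1.
Proof.
elim: l => [|[p om] l IH] //= srt; have srt' := path_sorted srt.
have rec : a \in merges l ->
    pclosed (unzip1 [seq q <- (p, om) :: l | q.2 < a.2]) a.1.
  move=> al /=; rewrite ltNge (sorted_merges (q := (p, om)) srt al) /=.
  exact: IH.
case: ifP => _; first exact: rec.
rewrite inE => /orP[/eqP->/=|/rec //]; rewrite ltxx.
apply: sub_pclosed (pclosed_small (unzip1 l) p) => q /mapP[b].
by rewrite mem_filter => /andP[_ bl] ->; apply: map_f.
Qed.

End Merges.

Section LevelSum.
Variable R : realType.
Implicit Types (L : seq R) (a b x y t : R) (phi psi : R -> R).

(* The integral of the step function equal to [phi b] between consecutive levels
   [a < b]. *)
Definition lsum L a phi := \sum_(q <- zip (a :: L) L) (q.2 - q.1) * phi q.2.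

Lemma lsum_cons b L a phi :
  lsum (b :: L) a phi = (b - a) * phi b + lsum L b phi.
Proof. by rewrite /lsum /= big_cons. Qed.

Lemma lsum_nil a phi : lsum [::] a phi = 0.
Proof. by rewrite /lsum big_nil. Qed.

Lemma lsumD L a phi psi :
  lsum L a (fun t => phi t + psi t) = lsum L a phi + lsum L a psi.
Proof. by rewrite /lsum -big_split; apply: eq_bigr => q _; rewrite mulrDr. Qed.

Lemma lsumB L a phi psi :
  lsum L a (fun t => phi t - psi t) = lsum L a phi - lsum L a psi.
Proof. by rewrite /lsum -sumrB; apply: eq_bigr => q _; rewrite mulrBr. Qed.

Lemma lsum_sum (I : Type) (r : seq I) (P : pred I) L a (F : I -> R -> R) :
  lsum L a (fun t => \sum_(i <- r | P i) F i t) = \sum_(i <- r | P i) lsum L a (F i).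
Proof.
rewrite /lsum exchange_big; apply: eq_bigr => q _; exact: mulr_sumr.
Qed.

Lemma ler_lsum L a phi psi : path <=%R a L ->
  {in L, forall t, phi t <= psi t} -> lsum L a phi <= lsum L a psi.
Proof.
elim: L a => [|b L IH] a; first by rewrite !lsum_nil.
move=> /= /andP[ab srt] h; rewrite !lsum_cons; apply: lerD.
  by apply: ler_wpM2l; rewrite ?subr_ge0 // h ?mem_head.
by apply: IH => // t tL; rewrite h // inE tL orbT.
Qed.

Lemma eq_lsum L a phi psi :
  {in L, phi =1 psi} -> lsum L a phi = lsum L a psi.
Proof.
elim: L a => [|b L IH] a h; first by rewrite !lsum_nil.
rewrite !lsum_cons h ?mem_head // (IH b) // => t tL.
by rewrite h // inE tL orbT.
Qed.

(** The intervals up to [y] telescope; [y] must be a breakpoint, since otherwise the sum would stop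
    at the breakpoint before it. *)
Lemma lsum_le L a y : path <=%R a L -> y \in a :: L ->
  lsum L a (fun t => (t <= y)%R%:R) = y - a.
Proof.
elim: L a => [|b L IH] a.
  by rewrite inE lsum_nil => _ /eqP ->; rewrite subrr.
move=> /= /andP[ab srt]; rewrite lsum_cons => yL.
have [ybL|nybL] := boolP (y \in b :: L).
  rewrite IH //; have -> : b <= y.
    move: ybL; rewrite inE => /orP[/eqP->//|].
    exact: (allP (order_path_min le_trans srt)).
  by rewrite mulr1 addrC addrA subrK.
(* Here [y = a] lies strictly below all remaining levels, so every term vanishes. *)
move: yL; rewrite inE (negbTE nybL) orbF => /eqP ya.
have lt t : t \in b :: L -> (t <= y) = false.
  move=> tbL; apply/negbTE; rewrite -ltNge lt_neqAle.
  rewrite (contraNneq _ nybL) => [|->//] /=.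
  rewrite ya; move: tbL; rewrite inE => /orP[/eqP->//|].
  by move/(allP (order_path_min le_trans srt)); apply: le_trans.
rewrite lt ?mem_head // mulr0 ya subrr add0r.
rewrite (@eq_lsum L b _ (fun=> 0)).
  by rewrite /lsum big1 // => q _; rewrite mulr0.
by move=> t tL; rewrite /= -ya lt // inE tL orbT.
Qed.

Lemma lsum_between L a x y : path <=%R a L -> x \in a :: L -> y \in a :: L ->
  x <= y -> lsum L a (fun t => ((x < t) && (t <= y))%:R) = y - x.
Proof.
move=> srt xL yL xy.
have -> : y - x = (y - a) - (x - a) by rewrite opprB addrA subrK.
rewrite -(lsum_le srt yL) -(lsum_le srt xL).
rewrite -lsumB; apply: eq_lsum => t _.
have [tx|xt] := leP t x; first by rewrite (le_trans tx xy) subrr.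
by rewrite subr0.
Qed.

End LevelSum.

(** * Spanning trees and levels *)

Section GraphLevels.
Variables (R : realType) (V E : finType) (eu ev : E -> V) (w : E -> R).
Implicit Types (S T X Y : {set E}) (e f : E) (x y : V) (t : R).
Local Notation conn := (conn eu ev).
Local Notation light := (light w).

Definition pairs S : seq (V * V) := [seq (eu e, ev e) | e <- enum S].

Definition ncompE S : nat := ncomp (pairs S).

Lemma conn_pconn S x y : conn S x y = pconn (pairs S) x y.
Proof.
apply: eq_connect => a b; rewrite /adj /padj; apply/exists_inP/orP.
  case=> e eS /orP[] /andP[/eqP<- /eqP<-]; [left|right];
    by apply: (map_f (fun e => (eu e, ev e))); rewrite mem_enum.
by case=> /mapP[e]; rewrite mem_enum => eS [-> ->]; exists e => //;
  rewrite !eqxx ?orbT.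
Qed.

Lemma pairs_sub S T : S \subset T -> {subset pairs S <= pairs T}.
Proof.
move=> /subsetP ST p /mapP[e]; rewrite mem_enum => eS ->.
by apply: map_f; rewrite mem_enum ST.
Qed.

Lemma mem_pairsU S T p : (p \in pairs (S :|: T)) = (p \in pairs S ++ pairs T).
Proof.
apply/idP/idP; last first.
  rewrite mem_cat => /orP[]; apply: pairs_sub;
  [exact: subsetUl|exact: subsetUr].
case/mapP => e; rewrite mem_enum mem_cat inE => /orP[] eS ->; apply/orP;
  [left|right]; by apply: (map_f (fun e => (eu e, ev e))); rewrite mem_enum.
Qed.

Lemma conn_mono S T x y : S \subset T -> conn S x y -> conn T x y.
Proof. by move=> ST; rewrite !conn_pconn; apply: pconnW (pairs_sub ST). Qed.

Lemma ncompE_setU1 e S : ncompE S = (ncompE (e |: S) + ~~ conn S (eu e) (ev e))%N.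
Proof.
rewrite conn_pconn /ncompE (ncomp_cons (pairs S) (eu e, ev e)); congr (_ + _)%N.
apply: ncomp_mem => p; rewrite mem_pairsU mem_cat inE; congr (_ || _).
by rewrite /pairs enum_set1 /= inE.
Qed.

Lemma ncompE_setD1 e S : e \in S ->
  ncompE (S :\ e) = (ncompE S + ~~ conn (S :\ e) (eu e) (ev e))%N.
Proof. by move=> eS; rewrite (ncompE_setU1 e) setD1K. Qed.

Lemma ncompE_le S T : S \subset T -> (ncompE T <= ncompE S)%N.
Proof. by move=> /pairs_sub; apply: ncomp_le. Qed.

Lemma ncompE_lt S T x y : T \subset S -> conn S x y -> ~~ conn T x y ->
  (ncompE S < ncompE T)%N.
Proof. by move=> /pairs_sub TS; rewrite !conn_pconn; apply: ncomp_lt. Qed.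

Lemma ncompE_supermod S1 S2 Y : S1 \subset S2 ->
  (ncompE S2 + ncompE (Y :|: S1) <= ncompE S1 + ncompE (Y :|: S2))%N.
Proof.
move=> /pairs_sub S12.
by rewrite /ncompE !(ncomp_mem (mem_pairsU _ _)); apply: ncomp_supermod.
Qed.

Lemma ncompE0 : ncompE finset.set0 = #|V|.
Proof. by rewrite /ncompE /pairs enum_set0 ncomp_nil. Qed.

Lemma connectedb_ncompE S x : connectedb eu ev S = (ncompE S == 1%N).
Proof.
apply/idP/eqP => [/forallP/(_ x)/forallP h|/ncomp_eq1 h].
  by apply: (ncomp_full (x0 := x)) => y; rewrite -conn_pconn.
by apply/forallP => y; apply/forallP => z; rewrite conn_pconn.
Qed.

Lemma cardsD1_pred S e k : e \in S -> #|S| = k.+1 -> #|S :\ e| = k.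
Proof. by move=> eS; rewrite (cardsD1 e S) eS add1n => -[]. Qed.

(** Deleting one edge creates at most one new component. *)
Lemma ncompE_card S T : T \subset S -> (ncompE T <= ncompE S + #|S :\: T|)%N.
Proof.
move: {2}#|_| (erefl #|S :\: T|) => k; elim: k S => [|k IH] S.
  move=> /eqP; rewrite cards_eq0 setD_eq0 => ST TS.
  by rewrite (eqP (_ : S == T)) ?leq_addr // eqEsubset ST.
move=> cD TS; have /card_gt0P[e] : (0 < #|S :\: T|)%N by rewrite cD.
rewrite in_setD => /andP[eT eS].
have DE : (S :\ e) :\: T = (S :\: T) :\ e by rewrite setDDl setUC -setDDl.
have cD' : #|(S :\ e) :\: T| = k.
  by rewrite DE; apply: cardsD1_pred cD; rewrite in_setD eT.
have TS' : T \subset S :\ e.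
  by rewrite finset.subsetD1 TS.
apply: leq_trans (IH _ cD' TS') _; rewrite cD' cD ncompE_setD1 // -addnA leq_add2l.
by case: conn; rewrite ?addn0 ?add0n // add1n.
Qed.

(** Acyclicity as an edge count: it passes to subsets and directly counts the edges of light
    parts. *)
Definition forest S := (ncompE S + #|S| == #|V|)%N.

Lemma forest_sub S T : T \subset S -> forest S -> forest T.
Proof.
move=> TS /eqP fS; rewrite /forest eqn_leq; apply/andP; split.
  rewrite -fS; have -> : #|S| = (#|S :\: T| + #|T|)%N.
    by rewrite -(cardsID T S) (finset.setIidPr TS) addnC.
  by rewrite addnA leq_add2r ncompE_card.
by have := ncompE_card (sub0set T); rewrite ncompE0 finset.setD0.
Qed.

Lemma forestP T :
  reflect {in T, forall e, ~~ conn (T :\ e) (eu e) (ev e)} (forest T).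
Proof.
apply: (iffP idP) => [fT e eT|].
  have := forest_sub (subD1set T e) fT; rewrite /forest -(eqP fT).
  rewrite ncompE_setD1 // (cardsD1 e T) eT -addnA eqn_add2l eqn_add2r.
  by case: conn.
move: {2}#|_| (erefl #|T|) => k; elim: k T => [|k IH] T.
  by move/eqP; rewrite cards_eq0 => /eqP -> _; rewrite /forest ncompE0 cards0 addn0.
move=> cT h; have /card_gt0P[e eT] : (0 < #|T|)%N by rewrite cT.
have cT' : #|T :\ e| = k.
  exact: cardsD1_pred cT.
have := IH _ cT'; rewrite /forest ncompE_setD1 // (h _ eT) cT' cT addn1 addSnnS.
apply => f; rewrite in_setD1 => /andP[_ fT]; apply: contra (h _ fT).
by apply: conn_mono; apply: setSD; apply: subD1set.
Qed.

Lemma spanning_treeE S T :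
  is_spanning_tree eu ev S T = [&& T \subset S, connectedb eu ev T & forest T].
Proof.
rewrite /is_spanning_tree; congr [&& _, _ & _].
by apply/forall_inP/forestP.
Qed.

Lemma light_sub S T t : S \subset T -> light S t \subset light T t.
Proof.
move=> /subsetP ST; apply/subsetP => e; rewrite !inE => /andP[/ST -> ->] //.
Qed.

Lemma light_subset S t : light S t \subset S.
Proof. by apply/subsetP => e; rewrite inE => /andP[]. Qed.

Lemma light_id S t : {in S, forall e, w e < t} -> light S t = S.
Proof.
move=> h; apply/setP => e; rewrite inE; case: (boolP (e \in S)) => //= eS.
exact: h.
Qed.

Lemma light_setD1 S e t : t <= w e -> light (S :\ e) t = light S t.
Proof.
move=> te; apply/setP => f; rewrite !inE; case: eqP => // -> /=.
by rewrite ltNge te andbF.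
Qed.

(** Induction on the removal of a heaviest edge [e], which is put back only if it joins two
    components. Levels up to [w e] do not see [e]; above [w e] the light parts are the full sets. *)
Lemma kruskal S : exists T, [/\ T \subset S, forest T, ncompE T = ncompE S &
  forall t, ncompE (light T t) = ncompE (light S t)].
Proof.
move: {2}#|_| (erefl #|S|) => k; elim: k S => [|k IH] S.
  move/eqP; rewrite cards_eq0 => /eqP ->; exists finset.set0; split => //.
  by rewrite /forest ncompE0 cards0 addn0.
move=> cS; have /card_gt0P[e0 e0S] : (0 < #|S|)%N by rewrite cS.
case: (@Order.TotalTheory.arg_maxP _ _ _ e0 (mem S) w e0S) => e eS emax.
have cS' : #|S :\ e| = k.
  exact: cardsD1_pred cS.
have [T [TS fT kT lT]] := IH _ cS'.
have TS' : T \subset S by apply: subset_trans TS (subD1set _ _).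
have eT : e \notin T by apply: contraL TS; move=> h; rewrite finset.subsetD1 h andbF.
have [c|nc] := boolP (conn (S :\ e) (eu e) (ev e)).
  have kS : ncompE T = ncompE S by rewrite kT ncompE_setD1 // c addn0.
  exists T; split => // t; have [et|te] := ltP (w e) t.
    have h : {in S, forall f, w f < t} by move=> f /emax; move/le_lt_trans; apply.
    by rewrite !light_id // => f /(subsetP TS'); apply: h.
  by rewrite lT light_setD1.
have eTS : e |: T \subset S by rewrite subUset sub1set (eS : e \in S).
have ncT : ~~ conn T (eu e) (ev e) by apply: contra nc; apply: conn_mono.
have kS : ncompE (e |: T) = ncompE S.
  have := ncompE_setU1 e T; rewrite ncT kT ncompE_setD1 // nc => /eqP.
  by rewrite eqn_add2r => /eqP.
exists (e |: T); split => //.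
  by move: fT; rewrite /forest (ncompE_setU1 e T) ncT cardsU1 eT addnA.
move=> t; have [et|te] := ltP (w e) t.
  have h : {in S, forall f, w f < t} by move=> f /emax; move/le_lt_trans; apply.
  by rewrite !light_id // => f /(subsetP eTS); apply: h.
by rewrite -(light_setD1 S te) -lT -(light_setD1 (e |: T) te) setU1K.
Qed.

Hypothesis w_ge0 : forall e, 0 <= w e.

(** Repeated weights are kept; they only contribute intervals of length zero to [lsum]. *)
Definition levels : seq R := sort <=%R [seq w e | e <- enum E].

Lemma mem_levels t : (t \in levels) = [exists e, t == w e].
Proof.
rewrite mem_sort; apply/mapP/existsP => [[e _ ->]|[e /eqP->]]; exists e => //.
by rewrite mem_enum.
Qed.

Lemma weight_level e : w e \in levels.
Proof. by rewrite mem_levels; apply/existsP; exists e. Qed.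

Lemma levels_path : path <=%R 0 levels.
Proof.
rewrite path_sortedE; last exact: le_trans.
apply/andP; split; last by apply: sort_sorted; apply: le_total.
by apply/allP => t; rewrite mem_levels => /existsP[e /eqP->].
Qed.

(* Layer-cake form of the spanning tree weight, shifted by a constant; it stays
   finite on disconnected graphs. *)
Definition mlev S : R := lsum levels 0 (fun t => (ncompE (light S t))%:R).

(** The total length of the level range: the shift between [mlev] and tree weights, which cancels in
    [pG]. *)
Definition mlev1 : R := lsum levels 0 (fun=> 1).

Lemma mlev_mono S T : T \subset S -> mlev S <= mlev T.
Proof.
move=> TS; apply: ler_lsum levels_path _ => t _.
by rewrite ler_nat ncompE_le // light_sub.
Qed.

Lemma mlev_supermod S1 S2 Y : S1 \subset S2 ->
  mlev S2 + mlev (Y :|: S1) <= mlev S1 + mlev (Y :|: S2).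
Proof.
move=> S12; rewrite -!lsumD; apply: ler_lsum levels_path _ => t _.
have lU S : light (Y :|: S) t = light Y t :|: light S t.
  by apply/setP => e; rewrite !inE andb_orl.
by rewrite -!natrD ler_nat !lU; apply/ncompE_supermod/light_sub.
Qed.

(** Each [w e] is the integral of the indicator of [t <= w e]. Since [T] and [light T t] are forests
    and [T] is connected, the tree edges of weight at least [t] number one less than the components
    of [light T t]. *)
Lemma tree_weight T : connectedb eu ev T -> forest T -> (0 < #|V|)%N ->
  \sum_(e in T) w e = mlev T - mlev1.
Proof.
move=> cT fT /card_gt0P[x _].
rewrite -lsumB.
under eq_bigr => e eT.
  rewrite -[w e]subr0 -(lsum_le levels_path (y := w e)); last first.
    by rewrite inE weight_level orbT.
  over.
rewrite -lsum_sum; apply: eq_lsum => t _ /=.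
have := fT; rewrite /forest; move: (cT); rewrite (connectedb_ncompE _ x) => /eqP ->.
rewrite -(eqP (forest_sub (light_subset T t) fT)).
rewrite -natr_sum.
have -> : #|T| = (#|light T t| + \sum_(e in T) (t <= w e)%R)%N.
  rewrite -[in LHS]sum1_card (bigID (fun e => w e < t)) /=; congr addn.
    by rewrite -sum1_card; apply: eq_bigl => e; rewrite inE.
  by rewrite big_mkcondr; apply: eq_bigr => e _; rewrite -leNgt; case: (_ <= _).
rewrite addnCA addnC eqn_add2r => /eqP <-.
by rewrite natrD addrAC subrr add0r.
Qed.

(** The Kruskal tree attains the value, and monotonicity of [mlev] bounds every other spanning tree
    from below. *)
Lemma MST_connected S : connectedb eu ev S -> (0 < #|V|)%N ->
  MST eu ev w S = (mlev S - mlev1)%:E.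
Proof.
move=> cS V0; apply/eqP; rewrite eq_le; apply/andP; split.
  have [T [TS fT kT lT]] := kruskal S.
  have cT : connectedb eu ev T.
    by case/card_gt0P: (V0) => x _; rewrite (connectedb_ncompE _ x) kT -connectedb_ncompE.
  apply: (@bigmin_inf _ _ _ _ T); first by rewrite spanning_treeE TS cT.
  rewrite lee_fin tree_weight // lerD2r.
  by apply: ler_lsum levels_path _ => t _; rewrite lT.
apply: le_bigmin => [|T]; first by rewrite leey.
rewrite spanning_treeE => /and3P[TS cT fT].
by rewrite lee_fin tree_weight // lerD2r mlev_mono.
Qed.

Lemma MST_disconnected S : ~~ connectedb eu ev S -> MST eu ev w S = +oo%E.
Proof.
move=> nS; rewrite /MST big_pred0 // => T; apply: contraNF nS.
case/and3P => TS /forallP cT _; apply/forallP => x; apply/forallP => y.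
by apply: conn_mono TS _; move/forallP: (cT x).
Qed.

End GraphLevels.

(** * Greedy cuts *)

Section GreedyBounds.
Variables (R : realType) (V E : finType) (eu ev : E -> V) (w c : E -> R).
Implicit Types (S T X Y C : {set E}) (e f : E) (x y : V) (t r : R).
Local Notation conn := (conn eu ev).
Local Notation light := (light w).
Local Notation cost := (cost c).
Local Notation levels := (levels w).
Local Notation mlev := (mlev eu ev w).

Hypothesis w_ge0 : forall e, 0 <= w e.
Hypothesis c_gt0 : forall e, 0 < c e.

Lemma cost_ge0 S : 0 <= cost S.
Proof. by apply: sumr_ge0 => e _; apply: ltW. Qed.

Lemma cost0 : cost finset.set0 = 0.
Proof. by rewrite /Defs.cost big_set0. Qed.

Lemma cost_gt0 S : (0 < cost S) = (S != finset.set0).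
Proof.
apply/idP/idP => [|/set0Pn[e eS]]; first by apply: contraTneq => ->; rewrite cost0 ltxx.
by rewrite /Defs.cost (bigD1 e) //= ltr_pwDl // sumr_ge0 // => f _; apply: ltW.
Qed.

Lemma cost_setID S T : cost S = cost (S :&: T) + cost (S :\: T).
Proof. by rewrite /Defs.cost (big_setID T). Qed.

Lemma cost_mono S T : S \subset T -> cost S <= cost T.
Proof.
by move=> ST; rewrite (cost_setID T S) (finset.setIidPr ST) lerDl cost_ge0.
Qed.

Lemma cost_setU S T : [disjoint S & T] -> cost (S :|: T) = cost S + cost T.
Proof. by move=> ST; rewrite /Defs.cost -bigU //; apply: eq_bigl => f; rewrite !inE. Qed.

(** Greedy maximality without division and for arbitrary separators, so that empty and non-minimum
    ones are covered. *)
Definition ratio_bound B' r S :=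
  forall e t X, e \in S -> t \in levels ->
    separates eu ev (light S t) (eu e) (ev e) X -> cost X <= B' ->
    t - w e <= r * cost X.

Lemma candidate_ratio_bound B' r S : 0 <= r ->
  (forall e t C, candidate eu ev w c B' S e t C -> Defs.ratio w c e t C <= r) ->
  ratio_bound B' r S.
Proof.
move=> r0 h e t X eS tL sX cX.
case: (@Order.TotalTheory.arg_minP _ _ _ X
  (separates eu ev (light S t) (eu e) (ev e)) cost sX) => C sC Cmin.
apply: (@le_trans _ _ (r * cost C)); last by apply: ler_wpM2l => //; apply: Cmin.
(* An empty cut is no candidate, but it separates only when [e] itself is not lighter than [t]. *)
have [C0|C0] := eqVneq C finset.set0.
  rewrite C0 cost0 mulr0 subr_le0 leNgt; apply/negP => et.
  move: sC; rewrite C0 /separates finset.setD0 => /andP[_ /negP]; apply.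
  rewrite conn_pconn; apply: (mem_pconn (p := (eu e, ev e))).
  by apply: (map_f (fun e => (eu e, ev e))); rewrite mem_enum inE eS.
have Cgt : 0 < cost C by rewrite cost_gt0.
rewrite -ler_pdivrMr //; apply: (h e t C); split => //.
- by move: tL; rewrite mem_levels => /existsP[e0 /eqP->]; exists e0.
- by rewrite Cgt (le_trans _ cX) // Cmin.
Qed.

Lemma exists_heaviest T x y : x != y -> conn T x y ->
  exists2 f, f \in T & {in T, forall g, w g <= w f}.
Proof.
move=> xy; have [->|/set0Pn[e eT] _] := eqVneq T finset.set0.
  rewrite conn_pconn /pairs enum_set0 => /connectP[[|z l]] /=.
    by move=> _ uv; rewrite uv eqxx in xy.
  by [].
case: (@Order.TotalTheory.arg_maxP _ _ _ e (mem T) w eT) => f fT fmax.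
by exists f.
Qed.

(* Once [C :&: Y] is gone, the endpoints of [e] have some bottleneck [a] below
   [t]; as [C :&: Y] cuts them at level [a], optimality of the ratio bounds
   [a - w e], and the rest of [C] pushes the bottleneck from [a] to [t]. *)
Lemma greedy_cut_residual B' S e t C Y :
  candidate eu ev w c B' S e t C -> 0 <= Defs.ratio w c e t C ->
  ratio_bound B' (Defs.ratio w c e t C) S ->
  Defs.ratio w c e t C * cost (C :\: Y) <= mlev (S :\: C) - mlev (S :\: (C :&: Y)).
Proof.
set r := Defs.ratio _ _ _ _ _.
move=> [eS [e0 tE] [/andP[CS nC] Cmin] /andP[C0 CB]] r0 bnd.
have tL : t \in levels by rewrite tE weight_level.
set X := C :&: Y.
have XC : X \subset C by apply: subsetIl.
have [CY|CY] := eqVneq (C :\: Y) finset.set0.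
  by rewrite CY cost0 mulr0 subr_ge0; apply: mlev_mono => //; apply: setDS.
have costC : cost C = cost X + cost (C :\: Y) by apply: cost_setID.
have XltC : cost X < cost C by rewrite costC ltrDl cost_gt0.
have uv : eu e != ev e.
  apply: contraNneq nC => ->; rewrite conn_pconn; exact: pconn_refl.
have CsubS : C \subset S by apply: subset_trans CS (light_subset _ _ _).
have lightD T Z s : light (T :\: Z) s = light T s :\: light Z s.
  apply/setP => f; rewrite !inE; case: (_ < s); rewrite ?andbF ?andbT //.
have lightC : light C t = C.
  by apply: light_id => f /(subsetP CS); rewrite inE => /andP[].
have lightX : light X t = X.
  by apply: light_id => f /(subsetP XC)/(subsetP CS); rewrite inE => /andP[].
(* The edges [f] below [t] whose weight suffices to connect the endpoints of [e] without [X]; the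
   least such weight is the bottleneck [a]. *)
pose P f := (w f < t) &&
  conn [set g in S :\: X | w g <= w f] (eu e) (ev e).
have exP s : s <= t -> conn (light (S :\: X) s) (eu e) (ev e) ->
    exists2 f, P f & w f < s.
  move=> st cs; have [f fT fmax] := exists_heaviest uv cs.
  have fs : w f < s by move: fT; rewrite inE => /andP[].
  exists f => //; rewrite /P (lt_le_trans fs st) /=.
  apply: conn_mono cs; apply/subsetP => g gT; rewrite inE fmax // andbT.
  by move: gT; rewrite inE => /andP[].
(* [X] is strictly cheaper than the minimum cut [C], so it cannot separate. *)
have ct : conn (light (S :\: X) t) (eu e) (ev e).
  apply: contraLR XltC => nc; rewrite -leNgt; apply: Cmin.
  rewrite /separates (subset_trans XC CS) /=.
  by rewrite lightD lightX in nc.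
have [f0 Pf0 _] := exP t (lexx t) ct.
case: (@Order.TotalTheory.arg_minP _ _ _ f0 P w Pf0) => f /andP[ft cf] fmin.
set a := w f in ft cf fmin.
have aL : a \in levels by apply: weight_level.
have nca : ~~ conn (light (S :\: X) a) (eu e) (ev e).
  apply/negP => /(exP a (ltW ft)) [g /fmin ag]; rewrite ltNge; by rewrite ag.
have bX : a - w e <= r * cost X.
  apply: (@le_trans _ _ (r * cost (light X a))).
    apply: bnd => //.
      rewrite /separates -lightD nca andbT.
      by apply: light_sub; apply: subset_trans XC CsubS.
    apply: le_trans CB; apply: cost_mono.
    by apply: subset_trans (light_subset _ _ _) XC.
  by apply: ler_wpM2l => //; apply: cost_mono; apply: light_subset.
have rC : r * cost C = t - w e by rewrite /r /Defs.ratio divfK // gt_eqF.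
apply: (@le_trans _ _ (t - a)).
  rewrite -(lerD2l (r * cost X)) -mulrDr -costC rC.
  by rewrite -[t - w e](subrKA a) addrC lerD2r.
have in0 s : s \in levels -> s \in 0 :: levels by rewrite inE orbC => ->.
rewrite -(lsum_between (levels_path w_ge0) (in0 _ aL) (in0 _ tL) (ltW ft)).
rewrite -lsumB; apply: ler_lsum (levels_path w_ge0) _ => s _.
rewrite lerBrDr -natrD ler_nat.
have sub : light (S :\: C) s \subset light (S :\: X) s.
  by apply: light_sub; apply: setDS.
(* At levels in [(a, t]] the endpoints of [e] are connected without [X] but not without [C], which
   gives one extra component. *)
case: (boolP ((a < s) && (s <= t))) => [/andP[as_ st]|_]; last exact: ncompE_le.
rewrite add1n; apply: (ncompE_lt sub (x := eu e) (y := ev e)).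
  apply: conn_mono cf; apply/subsetP => g; rewrite !inE.
  by case/andP => -> /= ga; apply: le_lt_trans ga as_.
have SCt : light S t :\: C = light (S :\: C) t by rewrite lightD lightC.
rewrite SCt in nC.
apply: contra nC; apply: conn_mono.
by apply/subsetP => g; rewrite !inE => /andP[->] /= gs; apply: lt_le_trans gs st.
Qed.

Lemma le_log2 k n : (2 ^ k <= n)%N -> k%:R <= log2 n%:R :> R.
Proof.
move=> kn; rewrite /log2 ler_pdivlMr; last by rewrite ln_gt0 // ltr1n.
rewrite mulr_natl -lnXn ?ltr0n // ler_ln ?posrE ?exprn_gt0 ?ltr0n //.
  by rewrite -natrX ler_nat.
by apply: leq_trans kn; rewrite expn_gt0.
Qed.

Lemma sum_indicator (I : Type) (s : seq I) (P : pred I) :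
  \sum_(i <- s) (P i)%:R = (count P s)%:R :> R.
Proof. by rewrite -natr_sum -sum1_count [in RHS]big_mkcond; congr _%:R; apply: eq_bigr => i _; case: (P i). Qed.

(* [S :\: X] is rebuilt by Kruskal's algorithm (star edges of maximal weight are
   added, since it may be disconnected).  Each merge at weight [t] with smaller
   side [A] is charged to the edges of [X] lighter than [t] leaving [A]: they
   form a cut of [S] at level [t]. A vertex lies at most [log2 #|V|] times on
   the smaller side. *)
Lemma removal_gain B' r S X : 0 <= r -> ratio_bound B' r S -> cost X <= B' ->
  (0 < #|V|)%N ->
  mlev (S :\: X) - mlev S <= r * (2 * log2 #|V|%:R) * cost X.
Proof.
move=> r0 bnd XB /card_gt0P[x0 _].
set H := S :\: X.
(* Star edges of this weight are lighter than no level, so they leave every light part unchanged. *)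
pose tmax := last 0 levels.
have le_tmax t : t \in levels -> t <= tmax.
  rewrite /tmax => tL; have := levels_path w_ge0; move: tL.
  move: (0 : R) => b; elim: (levels) b => // b' L IH b.
  rewrite inE /= => /orP[/eqP->|tL] /andP[_ pth]; last exact: IH.
  have := mem_last b' L; rewrite inE => /orP[/eqP->//|].
  exact: (allP (order_path_min le_trans pth)).
pose l0 := [seq ((eu e, ev e), w e) | e <- enum H] ++
           [seq ((x0, z), tmax) | z <- enum V].
pose l := sort (@heavier R V) l0.
have srt : sorted (@heavier R V) l := sort_sorted (@heavier_total R V) l0.
have kl : ncomp (unzip1 l) = 1%N.
  apply: (ncomp_full (x0 := x0)) => y; apply: (mem_pconn (p := (x0, y))).
  apply/mapP; exists ((x0, y), tmax) => //; rewrite mem_sort mem_cat.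
  by apply/orP; right; apply: (map_f (fun z => (x0, z, tmax))); rewrite mem_enum.
have filt t : t \in levels ->
    unzip1 [seq q <- l | q.2 < t] =i pairs eu ev (light H t).
  move=> tL p; apply/mapP/mapP => [[q]|[e]].
    rewrite mem_filter mem_sort mem_cat => /andP[qt /orP[]] /mapP[].
      move=> e; rewrite mem_enum => eH qE ->; exists e; rewrite ?qE //.
      by rewrite mem_enum inE eH; rewrite qE in qt.
    by move=> z _ qE; move: qt; rewrite qE /= ltNge le_tmax.
  rewrite mem_enum inE => /andP[eH et] ->; exists ((eu e, ev e), w e) => //.
  rewrite mem_filter et mem_sort mem_cat; apply/orP; left.
  by apply: (map_f (fun e => (eu e, ev e, w e))); rewrite mem_enum.
pose M := merges l.
pose bad t (a : {set V} * R) := (t <= a.2) && ~~ pclosed (pairs eu ev (light S t)) a.1.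
(* As [l] is connected, [light H t] has one component more than there are merges at weight at least
   [t]. Merges whose smaller side is closed in [light S t] number fewer than its components; the
   others are bad. *)
have level_count t : t \in levels ->
    (ncompE eu ev (light H t) <= count (bad t) M + ncompE eu ev (light S t))%N.
  move=> tL; rewrite /ncompE -(ncomp_mem (filt t tL)).
  rewrite -(count_merges_level t srt) kl.
  have := count_merges_pclosed l (pairs eu ev (light S t)).
  have := ncomp_gt0 (unzip1 l ++ pairs eu ev (light S t)) x0.
  rewrite -/M; move: (ncomp _) (ncomp _) => k1 k2 k1_gt0 hk.
  have split_count : (count (fun a : {set V} * R => t <= a.2)%R M <= count (bad t) M +
      count (fun a : {set V} * R => pclosed (pairs eu ev (light S t)) a.1) M)%N.
    elim: (M) => //= a M' IH; rewrite addnACA; apply: leq_add => //.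
    by rewrite /bad; case: (_ <= _) => //=; case: pclosed.
  apply: (leq_trans (leq_add split_count k1_gt0)).
  by rewrite -addnA leq_add2l.
pose cross (a : {set V} * R) f := (eu f \in a.1) != (ev f \in a.1).
pose Cut (a : {set V} * R) := [set f in X | [&& f \in S, w f < a.2 & cross a f]].
have same_side a f : a \in M -> f \in S -> w f < a.2 -> f \notin Cut a ->
    ~~ cross a f.
  move=> aM fS fa; rewrite !inE fS fa /=; case: (boolP (f \in X)) => //= fX _.
  have /allP := merges_pclosed srt aM; move=> /(_ (eu f, ev f)).
  rewrite /cross negbK; apply; apply/mapP; exists (eu f, ev f, w f) => //.
  rewrite mem_filter fa mem_sort mem_cat; apply/orP; left.
  by apply: (map_f (fun e => (eu e, ev e, w e))); rewrite mem_enum in_setD fX.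
have badP t a : a \in M -> bad t a -> exists2 f, f \in Cut a & w f < t.
  move=> aM /andP[ta /allPn[p /mapP[f]]]; rewrite mem_enum inE => /andP[fS ft] -> cr.
  exists f => //; apply: contraR cr; move/(same_side a f aM fS (lt_le_trans ft ta)).
  by rewrite negbK.
have charge a : a \in M -> lsum levels 0 (fun t => (bad t a)%:R) <= r * cost (Cut a).
  move=> aM; have [C0|/set0Pn[f0 f0C]] := eqVneq (Cut a) finset.set0.
    rewrite C0 cost0 mulr0 [leLHS](_ : _ = lsum levels 0 (fun=> 0)).
      by rewrite /lsum big1 // => q _; rewrite mulr0.
    apply: eq_lsum => t _; case: (boolP (bad t a)) => // /(badP t a aM)[f].
    by rewrite C0 inE.
  (* With [f] the lightest edge of the cut, the merge is bad only for [w f < t <= a.2]. The cut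
     separates the ends of [f] at level [a.2], so the ratio bound controls [a.2 - w f]. *)
  case: (@Order.TotalTheory.arg_minP _ _ _ f0 (mem (Cut a)) w f0C) => f fC fmin.
  have {}fC : f \in Cut a by [].
  have /and4P[fX fS fa fcr] : [&& f \in X, f \in S, w f < a.2 & cross a f].
    by move: fC; rewrite inE.
  have aL : a.2 \in levels.
    have := merges_weight aM => /mapP[q]; rewrite mem_sort mem_cat => /orP[] /mapP[].
      by move=> e _ -> ->; apply: weight_level.
    (* The edge [f] shows that [levels] is nonempty, so [tmax] is a genuine level and not the
       default 0. *)
    move=> z _ -> ->; rewrite /tmax; have := weight_level w f.
    by case: (levels) => // b L _; rewrite /= mem_last.
  apply: (@le_trans _ _ (a.2 - w f)); last first.
    apply: bnd => //.
      apply/andP; split.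
        by apply/subsetP => g; rewrite !inE => /and4P[_ -> -> _].
      rewrite conn_pconn; apply: contra fcr => cf.
      apply/eqP; apply: pclosed_pconn cf; apply/allP => p /mapP[g].
      rewrite mem_enum in_setD => /andP[gC]; rewrite inE => /andP[gS ga] -> /=.
      by have := same_side a g aM gS ga gC; rewrite negbK.
    apply: le_trans XB; apply: cost_mono; apply/subsetP => g.
    by rewrite inE => /andP[].
  have in0 s : s \in levels -> s \in 0 :: levels by rewrite inE orbC => ->.
  rewrite -(lsum_between (levels_path w_ge0) (in0 _ (weight_level w f)) (in0 _ aL) (ltW fa)).
  apply: ler_lsum (levels_path w_ge0) _ => t _.
  rewrite ler_nat; case: (boolP (bad t a)) => // bt.
  have [g gC gt] := badP t a aM bt.
  by rewrite (le_lt_trans (fmin g gC) gt); case/andP: bt => ->.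
rewrite -lsumB.
apply: (@le_trans _ _ (lsum levels 0 (fun t => \sum_(a <- M) (bad t a)%:R))).
  apply: ler_lsum (levels_path w_ge0) _ => t tL.
  by rewrite lerBlDr sum_indicator -natrD ler_nat level_count.
rewrite lsum_sum.
apply: (@le_trans _ _ (\sum_(a <- M) r * cost (Cut a))).
  by rewrite big_seq [leRHS]big_seq; apply: ler_sum => a; apply: charge.
rewrite -mulr_sumr -mulrA; apply: ler_wpM2l => //.
apply: (@le_trans _ _ (\sum_(a <- M) \sum_(f in X) c f * (f \in Cut a)%:R)).
  apply: ler_sum => a _; rewrite /Defs.cost [leLHS]big_mkcond [leRHS]big_mkcond.
  apply: ler_sum => f _; rewrite !inE.
  by case: (f \in X) => //=; case: ifP => _; rewrite ?mulr1 ?mulr0.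
rewrite exchange_big /Defs.cost mulr_sumr; apply: ler_sum => f fX.
rewrite -mulr_sumr mulrC; apply: ler_wpM2r; first exact: ltW.
(* An edge crossing the smaller side has an endpoint in it; summing over both endpoints produces the
   factor 2. *)
have side z : (count (fun a : {set V} * R => z \in a.1) M)%:R <= log2 #|V|%:R :> R.
  apply: le_log2; apply: leq_trans (count_merges l z) _.
  exact: max_card.
rewrite mulr2n mulrDl mul1r; apply: le_trans (lerD (side (eu f)) (side (ev f))).
rewrite -!sum_indicator -big_split; apply: ler_sum => a _ /=.
rewrite -natrD ler_nat inE fX /=.
by rewrite /cross; case: (_ \in a.1); case: (_ \in a.1); rewrite ?andbF ?andbT //; case: (_ && _).
Qed.

End GreedyBounds.

(** * Prefixes of a greedy run *)

Section Runs.
Variables (R : realType) (V E : finType) (eu ev : E -> V) (w c : E -> R).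
Implicit Types (s : seq ({set E} * R)) (i : nat).
Local Notation step s i := (nth (finset.set0 : {set E}, 0 : R) s i).

Lemma Fpre0 s : Fpre s 0 = finset.set0.
Proof. by rewrite /Fpre take0 big_nil. Qed.

Lemma FpreS s i : (i < size s)%N -> Fpre s i.+1 = Fpre s i :|: (step s i).1.
Proof.
by move=> si; rewrite /Fpre (take_nth (finset.set0 : {set E}, 0 : R) si) big_rcons.
Qed.

Lemma bpre0 s : bpre c s 0 = 0.
Proof. by rewrite /bpre take0 big_nil. Qed.

Lemma bpreS s i : (i < size s)%N ->
  bpre c s i.+1 = bpre c s i + cost c (step s i).1.
Proof.
by move=> si; rewrite /bpre (take_nth (finset.set0 : {set E}, 0 : R) si) big_rcons.
Qed.

Lemma Fpre_mono s i j : (i <= j)%N -> Fpre s i \subset Fpre s j.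
Proof.
move=> ij; rewrite /Fpre -(subnKC ij); move: (j - i)%N => k.
elim: k => [|k IH]; first by rewrite addn0.
have [lt|ge] := ltnP (i + k)%N (size s).
  by apply: (subset_trans IH); rewrite addnS -/(Fpre s _.+1) FpreS // subsetUl.
by move: IH; rewrite (take_oversize ge) (take_oversize (n := (i + k.+1)%N)) // addnS leqW.
Qed.

End Runs.

(** * The guarantee for the greedy output *)

Theorem mainTheorem16 (R : realType) (V E : finType) (eu ev : E -> V)
  (w c : E -> R) (Delta B B' : R) (s : seq ({set E} * R)) :
  simple_graph eu ev ->
  connectedb eu ev [set: E] ->
  (2 <= #|V|)%N ->
  (forall e, 0 <= w e) ->
  (forall e, 0 < c e) ->
  0 < Delta ->
  (exists Fs : {set E}, cost c Fs = B /\ pG eu ev w Fs = Delta%:E) ->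
  B <= B' ->
  (forall D : {set E}, ~~ connectedb eu ev (~: D) -> B' < cost c D) ->
  greedy_run eu ev w c B' Delta s ->
  (Delta%:E <= pG eu ev w (greedy_output eu ev w Delta s))%E /\
  cost c (greedy_output eu ev w Delta s) < (2 + 2 * log2 #|V|%:R) * B'.
Proof.
move=> _ cG V2 w0 c0 D0 [Fs [cFs pFs]] BB' _ [s0 hstep hcont hstop].
have V0 : (0 < #|V|)%N by apply: ltnW.
set lg : R := log2 #|V|%:R.
have lg1 : 1 <= lg by apply: (@le_log2 R 1%N); rewrite expn1.
have lg0 : 0 <= lg := le_trans ler01 lg1.
pose m D := mlev eu ev w (~: D).
have m_mono (D D' : {set E}) : D \subset D' -> m D <= m D'.
  by move=> DD'; apply: mlev_mono => //; rewrite setCS.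
have pG_fin D : connectedb eu ev (~: D) ->
    pG eu ev w D = (m D - m finset.set0)%:E.
  move=> cD; rewrite /pG !MST_connected // /m finset.setC0.
  by rewrite -EFinB opprB addrA subrK.
have pG_inf D : ~~ connectedb eu ev (~: D) -> pG eu ev w D = +oo%E.
  by move=> nD; rewrite /pG MST_disconnected // MST_connected.
have cFsC : connectedb eu ev (~: Fs).
  by apply: contraT => /pG_inf; rewrite pFs.
have mFs : m Fs = m finset.set0 + Delta.
  by apply/eqP; rewrite addrC -subr_eq -eqe -pFs pG_fin.
have Fs0 : Fs != finset.set0.
  apply: contraTneq D0 => E0; move: mFs; rewrite E0 -{1}[m _]addr0 => /addrI <-.
  by rewrite ltxx.
have B0 : 0 < B' by apply: lt_le_trans BB'; rewrite -cFs cost_gt0.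
pose C i := (nth (finset.set0 : {set E}, 0 : R) s i).1.
pose r i := (nth (finset.set0 : {set E}, 0 : R) s i).2.
pose F i := Fpre s i.
have FS i : (i < size s)%N -> F i.+1 = F i :|: C i by apply: FpreS.
have CF i : (i < size s)%N -> C i \subset ~: F i.
  rewrite /C => /hstep [[_ [e [W [[_ _ [/andP[sub _] _] _] _ _]]]]|[_ -> _]].
    by apply: subset_trans sub (light_subset _ _ _).
  exact: sub0set.
have CB i : (i < size s)%N -> cost c (C i) <= B'.
  rewrite /C => /hstep [[_ [e [W [[_ _ _ /andP[_ h]] _ _]]]]|[_ -> _]] //.
  by rewrite cost0 ltW.
have r_ge0 i : (i < size s)%N -> 0 <= r i.
  by rewrite /r => /hstep [[/ltW]|[-> _ _]].
have bnd i : (i < size s)%N -> ratio_bound eu ev w c B' (r i) (~: F i).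
  move=> si; apply: candidate_ratio_bound => //; first exact: r_ge0.
  by rewrite /r => e t X; case: (hstep i si) => [[_ [_ [_ [_ _]]]]|[-> _]]; apply.
have cost_F i : (i <= size s)%N -> cost c (F i) = bpre c s i.
  elim: i => [_|i IH si]; first by rewrite /F Fpre0 bpre0 cost0.
  rewrite bpreS // FS // cost_setU ?IH // 1?ltnW //.
  by rewrite disjoint_sym disjoints_subset CF.
have kE : (size s).-1.+1 = size s by rewrite prednK.
set k := (size s).-1 in kE.
have kS : (k < size s)%N by rewrite -kE.
have bud : cost c (F (size s)) < (2 + 2 * lg) * B'.
  rewrite cost_F // -kE bpreS // -/(C k).
  have -> : (2 + 2 * lg) * B' = (1 + 2 * lg) * B' + B' by rewrite -[2]/(1+1) addrAC mulrDl mul1r.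
  apply: ltr_leD; last exact: CB.
  (* The first step is preceded by no continuation test, but then nothing has been spent before
     it. *)
  have [->|k0] := posnP k; last by have [] := hcont k; rewrite ?k0 ?kS.
  by rewrite bpre0 mulr_gt0 // ltr_wpDr // mulr_ge0.
have bud0 : 0 < (2 + 2 * lg) * B'.
  by rewrite mulr_gt0 // ltr_wpDr // mulr_ge0.
suff Fgood : (Delta%:E <= pG eu ev w (F (size s)))%E.
  by rewrite /greedy_output Fgood.
have [cF|/pG_inf ->] := boolP (connectedb eu ev (~: F (size s))); last exact: leey.
pose D := F (size s) :&: Fs.
(* By supermodularity, [Fs] is still worth [m Fs - m D] after removing [F i]. *)
have gap i : (i < size s)%N ->
    Delta - (m D - m finset.set0) <= r i * (2 * lg) * B'.
  move=> si; have := removal_gain (X := Fs) w0 c0 (r_ge0 i si) (bnd i si).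
  rewrite cFs BB' V0 => /(_ isT isT) h.
  have {}h : m (F i :|: Fs) - m (F i) <= r i * (2 * lg) * B'.
    rewrite /m setCU -setDE; apply: le_trans h _; apply: ler_wpM2l => //.
    by rewrite mulr_ge0 ?r_ge0 // mulr_ge0.
  apply: le_trans h.
  have sm := mlev_supermod eu ev w0 (S1 := ~: (F i :|: Fs)) (S2 := ~: Fs) (Fs :\: F i).
  have {}sm : m Fs + m (F i) <= m (F i :|: Fs) + m (F i :&: Fs).
    have := sm; rewrite setCS finset.subsetUr => /(_ isT).
    have -> : Fs :\: F i :|: ~: (F i :|: Fs) = ~: F i.
      by apply/setP => f; rewrite !inE; do 2!case: (_ \in _).
    have -> // : Fs :\: F i :|: ~: Fs = ~: (F i :&: Fs).
    by apply/setP => f; rewrite !inE; do 2!case: (_ \in _).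
  have mD : m (F i :&: Fs) <= m D.
    by apply/m_mono/finset.setSI/Fpre_mono/ltnW.
  move: sm mD; rewrite mFs; move: (m _) (m _) (m _) (m _) (m _) => a1 a2 a3 a4 a5.
  lra.
(* With a zero ratio, [gap] says that removing [D] alone already gains [Delta]. *)
have stop_r0 : ~ 0 < r k -> (Delta%:E <= pG eu ev w (F (size s)))%E.
  move=> nr; have rk : r k = 0.
    by apply/eqP; rewrite eq_le r_ge0 // andbT leNgt; apply/negP.
  have := gap k kS; rewrite rk !mul0r subr_le0 => h.
  rewrite pG_fin // lee_fin; apply: le_trans h _; rewrite lerD2r.
  by apply: m_mono; apply: subsetIl.
have [rk|/negP] := boolP (0 < r k); last exact: stop_r0.
have [//|ltD] := leP Delta%:E (pG eu ev w (F (size s))).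
(* Of the three continuation conditions only the budget one can still fail. *)
have bB : (1 + 2 * lg) * B' <= bpre c s (size s).
  by rewrite leNgt; apply/negP => ltb; apply: hstop; split.
move: ltD; rewrite ltNge => /negP; case.
(* By [gap], a lower bound on all ratios of the run. *)
set rho := (Delta - (m D - m finset.set0)) / (2 * lg * B').
have den0 : 0 < 2 * lg * B' by rewrite mulr_gt0 // mulr_gt0 // (lt_le_trans ltr01).
(* [D] is removed from the outset, so only cost outside [Fs] has to be paid for; at the end [D] is
   absorbed by [F (size s)]. *)
have progress i : (i <= size s)%N ->
    rho * cost c (F i :\: Fs) <= m (F i :|: D) - m D.
  elim: i => [_|i IH si].
    rewrite /F Fpre0 finset.set0D cost0 mulr0 subr_ge0.
    by apply: m_mono; apply: subsetUr.
  have Csub : C i \subset F (size s).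
    by apply: subset_trans (Fpre_mono s si); rewrite -/(F _) FS // subsetUr.
  have CDE : C i :\: D = C i :\: Fs.
    apply/setP => f; rewrite !inE negb_and.
    by case: (boolP (f \in C i)) => [/(subsetP Csub) ->|]; rewrite ?andbF.
  have -> : F i.+1 :\: Fs = (F i :\: Fs) :|: (C i :\: Fs) by rewrite FS // finset.setDUl.
  rewrite cost_setU; last first.
    rewrite disjoint_sym disjoints_subset; apply/subsetP => f; rewrite in_setD.
    by case/andP => _ /(subsetP (CF i si)); rewrite !inE => /negbTE ->; rewrite andbF.
  rewrite mulrDr; have {}IH := IH (ltnW si).
  have rhor : rho * cost c (C i :\: Fs) <= r i * cost c (C i :\: Fs).
    apply: ler_wpM2r; first exact: cost_ge0.
    by rewrite /rho ler_pdivrMr // mulrA gap.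
  have resid : r i * cost c (C i :\: Fs) <= m (F i.+1) - m (F i :|: (C i :&: D)).
    rewrite -CDE /m FS // !setCU -!setDE /C /r.
    case: (hstep i si) => [[ri [e [W [cand rE _]]]]|[-> CE _]].
      have h := greedy_cut_residual w0 c0 D cand.
      rewrite -rE in h; apply: h; [exact: ltW|exact: bnd].
    by rewrite mul0r subr_ge0 /C CE finset.set0I.
  (* Removing [C i :\: D] gains at least as much once all of [D] is gone as when only [C i :&: D]
     is. *)
  have sm : m (F i.+1) + m (F i :|: D) <= m (F i.+1 :|: D) + m (F i :|: (C i :&: D)).
    have := mlev_supermod eu ev w0 (S1 := ~: (F i.+1 :|: D)) (S2 := ~: F i.+1) (C i :\: D).
    rewrite setCS finset.subsetUl => /(_ isT).
    have CFi f : f \in C i -> f \notin F i.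
      by move=> /(subsetP (CF i si)); rewrite inE.
    have -> : C i :\: D :|: ~: (F i.+1 :|: D) = ~: (F i :|: D).
      apply/setP => f; rewrite FS // !in_setU !in_setD !in_setC !in_setU.
      have := CFi f; case: (f \in C i) => [/(_ isT)/negbTE->|_];
        by case: (f \in D); case: (f \in F i).
    have -> // : C i :\: D :|: ~: F i.+1 = ~: (F i :|: (C i :&: D)).
    apply/setP => f; rewrite FS // !in_setU !in_setD !in_setC !in_setU in_setI.
    have := CFi f; case: (f \in C i) => [/(_ isT)/negbTE->|_];
      by case: (f \in D); case: (f \in F i).
  move: IH rhor resid sm.
  move: (m _) (m _) (m _) (m _) (m _) (rho * _) (rho * _) (r i * _).
  move=> a1 a2 a3 a4 a5 a6 a7 a8; lra.
have := progress _ (leqnn _).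
have -> : F (size s) :|: D = F (size s) by apply: setUidPl; apply: subsetIl.
(* At most [B <= B'] of the spent budget lies inside [Fs]. *)
have big : 2 * lg * B' <= cost c (F (size s) :\: Fs).
  move: bB; rewrite -cost_F // (cost_setID c _ Fs).
  have : cost c (F (size s) :&: Fs) <= cost c Fs by apply: cost_mono => //; apply: subsetIr.
  rewrite cFs mulrDl mul1r; move: BB'; move: (cost _ _) (cost _ _) (2 * lg * B').
  move=> a1 a2 a3; lra.
move=> prog; rewrite pG_fin // lee_fin.
(* Either [D] alone suffices, or [rho] is nonnegative and multiplying it by [big] gives exactly the
   missing gain. *)
have [small|large] := leP Delta (m D - m finset.set0).
  by apply: le_trans small _; rewrite lerD2r; apply: m_mono; apply: subsetIl.
have rho0 : 0 <= rho by apply: divr_ge0; rewrite ?subr_ge0; apply: ltW.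
have := ler_wpM2l rho0 big; rewrite {1}/rho divfK ?gt_eqF // => h.
by move: (le_trans h prog); move: (m _) (m _) (m _) => a1 a2 a3; lra.
Qed.
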